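(* Let $\mathcal{S}$ be a set of states, $\mathcal{A}$ a finite nonempty set of actions, $\beta>0$, $r:\mathcal{A}\times\mathcal{S}\to\mathbb{R}$ a reward function, and $\pi_{\mathrm{ref}}(\cdot\mid s)$, $s\in\mathcal{S}$, a reference policy with $\pi_{\mathrm{ref}}(a\mid s)>0$ for all $a\in\mathcal{A}$, $s\in\mathcal{S}$. Define the modified reward $$r'(a,s)=r(a,s)+\beta\log\pi_{\mathrm{ref}}(a\mid s).$$ Then, in the bandit setting (one decision per episode), the optimal solution of the maximum entropy reinforcement learning problem with reward $r'$ is $$\pi_*(a\mid s)=\frac{1}{Z(s)}\,\pi_{\mathrm{ref}}(a\mid s)\exp\Big(\frac{1}{\beta}r(a,s)\Big),\qquad a\in\mathcal{A},\ s\in\mathcal{S},$$ where $Z(s)=\sum_{a'\in\mathcal{A}}\pi_{\mathrm{ref}}(a'\mid s)\exp\big(\frac{1}{\beta}r(a',s)\big)$ is the normalizing constant. That is, for every $s\in\mathcal{S}$, $\pi_*(\cdot\mid s)$ is the unique maximizer, over all probability distributions $\pi(\cdot\mid s)$ on $\mathcal{A}$, of $$\mathbb{E}_{a\sim\pi(\cdot\mid s)}\big[r'(a,s)\big]+\beta\,\mathcal{H}(\pi(\cdot\mid s)).$$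
   Context: A policy assigns to each state $s\in\mathcal{S}$ a probability distribution $\pi(\cdot\mid s)$ on $\mathcal{A}$. $\mathcal{H}(\pi(\cdot\mid s))=-\sum_{a\in\mathcal{A}}\pi(a\mid s)\log\pi(a\mid s)$ is the Shannon entropy, with the convention $0\log 0=0$. The maximum entropy reinforcement learning problem is to choose the policy maximizing the expected total reward plus $\beta$ times the entropy of the policy. The bandit assumption means that each episode consists of a single decision: from state $s$ one action $a$ is taken, the reward is received and the episode ends, so there is no future value and the soft action-value function equals the immediate reward, $Q(s,a)=r'(a,s)$. *)

(* Defs.v *)
From HB Require Import structures.
From mathcomp Require Import all_boot all_order all_algebra.
From mathcomp Require Import reals sequences exp.

Set Implicit Arguments.
Unset Strict Implicit.
Unset Printing Implicit Defensive.

Import Order.TTheory GRing.Theory Num.Theory.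
Local Open Scope ring_scope.

Section FiniteDistributions.
Context {R : realType} {A : finType}.

Definition is_dist (p : A -> R) : Prop :=
  (forall a, 0 <= p a) /\ \sum_(a : A) p a = 1.

Definition expectation (p f : A -> R) : R := \sum_(a : A) p a * f a.

(* Natural logarithm; 0 log 0 = 0 holds since the factor p a is 0. *)
Definition entropy (p : A -> R) : R := - \sum_(a : A) p a * ln (p a).

End FiniteDistributions.

Definition is_maximizer {R : realType} {T : Type} (D : T -> Prop) (J : T -> R)
    (x : T) : Prop :=
  D x /\ forall y, D y -> J y <= J x.

Definition is_unique_maximizer {R : realType} {T : Type} (D : T -> Prop)
    (J : T -> R) (x : T) : Prop :=
  is_maximizer D J x /\ forall y, is_maximizer D J y -> y = x.

Section MaxEntBandit.
Context {R : realType} {S : Type} {A : finType}.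

(* [pi s a] is the probability pi(a | s); rewards take the action first. *)
Definition is_policy (pi : S -> A -> R) : Prop := forall s, is_dist (pi s).

(* An episode is a single decision taken in state s, so the total reward is the
   immediate reward [rew a s], which is also the soft action value Q(s, a). *)
Definition maxent_objective (beta : R) (rew : A -> S -> R) (s : S)
    (p : A -> R) : R :=
  expectation p (fun a => rew a s) + beta * entropy p.

Definition modified_reward (beta : R) (r : A -> S -> R) (pi_ref : S -> A -> R)
    (a : A) (s : S) : R :=
  r a s + beta * ln (pi_ref s a).

Definition partition_function (beta : R) (r : A -> S -> R)
    (pi_ref : S -> A -> R) (s : S) : R :=
  \sum_(a : A) pi_ref s a * expR (1 / beta * r a s).

Definition pi_star (beta : R) (r : A -> S -> R) (pi_ref : S -> A -> R)
    (s : S) (a : A) : R :=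
  1 / partition_function beta r pi_ref s
    * pi_ref s a * expR (1 / beta * r a s).

End MaxEntBandit.

(* Main.v *)
(* Since r' = beta * (ln pi_star + ln Z), the objective at p equals
   beta * ln Z - beta * KL(p || pi_star), so Gibbs' inequality and its
   equality case give the claim. *)
Require Import Defs.
From HB Require Import structures.
From mathcomp Require Import all_boot all_order all_algebra.
From mathcomp Require Import boolp reals sequences exp.
From mathcomp Require Import ring.

Import Order.TTheory GRing.Theory Num.Theory.
Local Open Scope ring_scope.

(** Up to the constant [beta * ln Z], the objective is minus [beta] times the relative entropy of
    [p] with respect to [pi_star] ([maxent_objective_gibbs]). Gibbs' inequality ([gibbs_leif]) sums
    a pointwise bound that comes from [1 + x <= expR x]. Using [?= iff] throughout carries the
    equality case along, so optimality and uniqueness come from the single statement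
    [maxent_objective_leif]. *)

Lemma mul_lnB_leif (R : realType) (p q : R) (p_ge0 : 0 <= p) (q_gt0 : 0 < q) :
  p * (ln q - ln p) <= q - p ?= iff (p == q).
Proof.
have [->|p_neq_q] := eqVneq p q.
  by rewrite !subrr mulr0; apply/leif_refl.
suff lt_pq : p * (ln q - ln p) < q - p.
  by split; [exact: ltW | exact: lt_eqF].
(* When [p = 0] the left side is 0 whatever the value of [ln 0], and the right side is [q > 0]. *)
move: p_ge0; rewrite le_eqVlt => /predU1P[<-|p_gt0].
  by rewrite mul0r subr0.
have ln_neq0 : ln q - ln p != 0.
  rewrite subr_eq0; apply: contra_neq p_neq_q => eq_ln.
  by apply: ln_inj; rewrite ?posrE.
(* Strict convexity: [1 + x < expR x] at [x = ln q - ln p], where [expR x = q / p]; multiply by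
   [p]. *)
have := expR_gt1Dx ln_neq0.
rewrite expRD expRN !lnK ?posrE // -(ltr_pM2l p_gt0) mulrCA divff ?gt_eqF //.
by rewrite mulr1 mulrDr mulr1 ltrBrDl.
Qed.

(** Both distributions have mass 1, so the pointwise upper bounds [q a - p a] sum to 0; equality of
    the sums forces equality in every term. *)
Lemma gibbs_leif (R : realType) (A : finType) (p q : A -> R)
    (p_dist : is_dist p) (q_dist : is_dist q) (q_gt0 : forall a, 0 < q a) :
  \sum_a p a * (ln (q a) - ln (p a)) <= 0 ?= iff [forall a, p a == q a].
Proof.
have [p_ge0 p_sum] := p_dist; have [_ q_sum] := q_dist.
have sum0 : \sum_a (q a - p a) = 0 by rewrite sumrB p_sum q_sum subrr.
rewrite -[X in _ <= X ?= iff _]sum0.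
by apply: leif_sum => a _; apply: mul_lnB_leif.
Qed.

Section PiStar.
Context {R : realType} {S : Type} {A : finType}.
Variables (beta : R) (r : A -> S -> R) (pi_ref : S -> A -> R) (s : S).
Hypothesis A_gt0 : (0 < #|A|)%N.
Hypothesis beta_gt0 : 0 < beta.
Hypothesis ref_gt0 : forall a, 0 < pi_ref s a.

Let Z := partition_function beta r pi_ref s.
Let q := pi_star beta r pi_ref s.

Lemma partition_function_gt0 : 0 < Z.
Proof.
have /card_gt0P[a0 _] := A_gt0.
rewrite /Z /partition_function (bigD1 a0) //= ltr_pwDl ?mulr_gt0 ?expR_gt0 //.
by apply: sumr_ge0 => a _; rewrite mulr_ge0 ?expR_ge0 // ltW.
Qed.

Lemma pi_star_gt0 a : 0 < q a.
Proof.
rewrite /q /pi_star -/Z div1r mulr_gt0 ?expR_gt0 // mulr_gt0 //.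
by rewrite invr_gt0 partition_function_gt0.
Qed.

Lemma pi_star_dist : is_dist q.
Proof.
split=> [a|]; first exact/ltW/pi_star_gt0.
rewrite /q /pi_star; under eq_bigr do rewrite -mulrA.
rewrite -mulr_sumr -/(partition_function beta r pi_ref s) -/Z div1r mulVf //.
by rewrite gt_eqF // partition_function_gt0.
Qed.

(** Taking [ln] of the Gibbs form of [q] produces [- ln Z], which the added [ln Z] cancels. *)
Lemma modified_reward_pi_star a :
  modified_reward beta r pi_ref a s = beta * (ln (q a) + ln Z).
Proof.
have Z_gt0 := partition_function_gt0.
rewrite /q /pi_star -/Z div1r !lnM ?posrE ?mulr_gt0 ?invr_gt0 ?expR_gt0 //.
rewrite lnV ?posrE // expRK /modified_reward.
by field; rewrite gt_eqF.
Qed.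

Lemma maxent_objective_gibbs (p : A -> R) : is_dist p ->
  maxent_objective beta (modified_reward beta r pi_ref) s p =
  beta * ln Z + beta * \sum_a p a * (ln (q a) - ln (p a)).
Proof.
move=> [_ p_sum]; rewrite /maxent_objective /expectation /entropy.
(* As [p] has mass 1, the constant is its own average under [p], and both sides can be compared term
   by term. *)
have -> : beta * ln Z = \sum_a p a * (beta * ln Z).
  by rewrite -mulr_suml p_sum mul1r.
rewrite mulrN !mulr_sumr -sumrB -big_split /=.
by apply: eq_bigr => a _; rewrite modified_reward_pi_star; ring.
Qed.

Lemma maxent_objective_leif (p : A -> R) : is_dist p ->
  maxent_objective beta (modified_reward beta r pi_ref) s p <=
  maxent_objective beta (modified_reward beta r pi_ref) s q
    ?= iff [forall a, p a == q a].
Proof.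
move=> p_dist; rewrite !maxent_objective_gibbs //; last exact: pi_star_dist.
(* The relative entropy of [q] with respect to itself vanishes. *)
rewrite [X in _ <= _ + _ * X ?= iff _]big1; last first.
  by move=> a _; rewrite subrr mulr0.
have [le0 eq0] := gibbs_leif _ _ _ _ p_dist pi_star_dist pi_star_gt0.
split; first by rewrite lerD2l ler_pM2l.
rewrite (inj_eq (addrI _)) -eq0; apply/inj_eq/mulfI.
by rewrite gt_eqF.
Qed.

End PiStar.

Theorem proposition1 (R : realType) (S : Type) (A : finType)
  (hA : (0 < #|A|)%N)
  (beta : R) (hbeta : 0 < beta)
  (r : A -> S -> R) (pi_ref : S -> A -> R)
  (href : is_policy pi_ref)
  (hpos : forall (s : S) (a : A), 0 < pi_ref s a) :
  forall s : S,
    is_unique_maximizer (@is_dist R A)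
      (maxent_objective beta (modified_reward beta r pi_ref) s)
      (pi_star beta r pi_ref s).
Proof.
move=> s.
have q_dist := pi_star_dist beta r pi_ref s hA (hpos s).
have J_leif := maxent_objective_leif beta r pi_ref s hA hbeta (hpos s).
split; first by split=> // p /J_leif[].
move=> p [p_dist p_max]; apply/funext => a; apply/eqP.
have [le_pq eq_pq] := J_leif p p_dist.
(* Another maximizer [p] attains the same value as [pi_star], so the equality case applies. *)
have /forallP : [forall a, p a == pi_star beta r pi_ref s a].
  by rewrite -eq_pq eq_le le_pq p_max.
exact.
Qed.
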